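(* Let $X$ be a regular, $T_1$, $W$-space of G. Then $X$ is hereditarily Baire if and only if each perfect set in $X$ is uncountable.
   Context: $X$ is hereditarily Baire if all non-void closed subsets of $X$ are Baire spaces in the subspace topology (Baire: no non-void open subset is meager). A perfect set in $X$ is a non-void closed subset without isolated points in the subspace topology. For $x\in X$, a $\mathscr{G}_x(X)$-play is a sequence $\{(x_i,W_i)\}_{i=1}^\infty$ with $x_1=x$, each $W_i$ an open neighborhood of $x$, and $x_{i+1}\in W_i$ for all $i$; Player $\beta$ moves first and picks the $x_i$, Player $\alpha$ picks the $W_i$, alternately. Player $\alpha$ wins the play if $x$ is a cluster point of the sequence $\{x_i\}$ (every neighborhood of $x$ contains $x_i$ for infinitely many indices $i$); otherwise Player $\beta$ wins. The point $x$ is a $W$-point of G (Gruenhage) if Player $\alpha$ has a winning strategy in the $\mathscr{G}_x(X)$-game, a strategy being a rule choosing each $W_i$ from $(x_1,\dots,x_i)$. $X$ is a $W$-space of G if every point of $X$ is a $W$-point of G. *)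

(* Defs.v *)
From mathcomp Require Import all_boot all_classical.
From mathcomp Require Import topology.

Set Implicit Arguments.
Unset Strict Implicit.
Unset Printing Implicit Defensive.

Local Open Scope classical_set_scope.

Definition nowhere_dense (T : topologicalType) (A : set T) :=
  interior (closure A) = set0.

Definition meager (T : topologicalType) (A : set T) :=
  exists2 F : nat -> set T,
    (forall n, nowhere_dense (F n)) & A `<=` \bigcup_n F n.

Definition baire_space (T : topologicalType) :=
  forall U : set T, open U -> U !=set0 -> ~ meager U.

(* [set_type F] carries the topology induced by [X]; the library type
   [subspace F] would not do here, as its carrier is all of [X]. *)
Definition hereditarily_baire (X : topologicalType) :=
  forall F : set X, closed F -> F !=set0 -> baire_space (set_type F).

(* Plays are indexed from 0: [xs i] and [W i] are the i-th moves of beta and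
   alpha in the game at [x]. *)
Definition is_play (X : topologicalType) (x : X)
    (xs : nat -> X) (W : nat -> set X) :=
  [/\ xs 0 = x, forall i, open_nbhs x (W i) & forall i, W i (xs i.+1)].

Definition alpha_wins (X : topologicalType) (x : X) (xs : nat -> X) :=
  forall U : set X, nbhs x U -> infinite_set [set i | U (xs i)].

Definition alpha_strategy (X : topologicalType) (x : X)
    (sigma : seq X -> set X) :=
  forall s : seq X, open_nbhs x (sigma s).

(* [mkseq xs i.+1] is [:: xs 0; ...; xs i], the moves of beta known to alpha
   when choosing [W i]. *)
Definition follows (X : topologicalType) (sigma : seq X -> set X)
    (xs : nat -> X) (W : nat -> set X) :=
  forall i, W i = sigma (mkseq xs i.+1).

Definition winning_strategy (X : topologicalType) (x : X)
    (sigma : seq X -> set X) :=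
  alpha_strategy x sigma /\
  forall xs W, is_play x xs W -> follows sigma xs W -> alpha_wins x xs.

Definition W_point (X : topologicalType) (x : X) :=
  exists sigma : seq X -> set X, winning_strategy x sigma.

Definition W_space (X : topologicalType) := forall x : X, W_point x.

(* [perfect_set] allows the empty set; by [perfectP] it amounts to being
   closed without isolated points. *)
Definition nonvoid_perfect (X : topologicalType) (P : set X) :=
  P !=set0 /\ perfect_set P.

(* Main.v *)
Require Import Defs.
From mathcomp Require Import all_boot all_classical.
From mathcomp Require Import topology.

Local Open Scope classical_set_scope.

(** A countable perfect set P refutes hereditary Baireness at once: in a T1
    space the points of P are nowhere dense in P, since none is isolated, so P
    is meager in itself ([perfect_countable_meager]).

    For the converse, suppose that a closed F has a nonempty relatively open
    subset that is meager in F.  Regularity shrinks it to a nonempty closed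
    set Z = closure (V `&` F), with V open, covered by countably many closed
    sets that are nowhere dense in Z.  Replacing these by their finite unions
    gives an increasing cover E of Z, and r z denotes an index with z in
    E (r z).  A countable perfect set inside Z is then built as an
    omega-branching tree of points d n with open neighborhoods O n
    ([countable_perfect_exists]).  A child c of a node p obeys three rules:
    O c lies inside O p; the closure of O c misses E (r (d p)), which is
    possible because E (r (d p)) is closed and nowhere dense in Z; and O c lies
    inside the answer of Player alpha, in the game at d p, to all points
    chosen so far.

    The third rule replaces first countability.  The subtree of p cannot be
    treated as a single sequence of moves at d p, as it also accumulates at
    the children of p.  But let alpha's answer be good against every
    subsequence of the past simultaneously ([W_point_subsequence]).  Points
    taken from infinitely many different branches below p can be thinned so
    that each one lies in a branch opened after the previous one was chosen;
    the thinned sequence is a legal play, and so clusters at d p.  Hence every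
    neighborhood of d p contains all but finitely many of the branches below p
    ([branches_converge]).

    Therefore each d p is a limit of its children, which differ from it by
    the second rule, so the tree is crowded ([tree_crowded]).  It is also
    closed ([tree_closed]): a point z of its closure that is not a node, being
    in the closure of the subtree of p, is in the closure of the subtree of a
    child of p ([closure_subtree]).  Descending forever, z lies in the closure
    of O c for nodes c whose parents have arbitrarily large rank r, so by the
    second rule z lies in no E n, while z is in Z. *)

(** * Sequences *)

(** The tree is grown one node at a time, each new node depending on all the
    earlier ones. *)
Lemma history_recursion (T : Type) (f : seq T -> T) :
  exists u : nat -> T, forall n, u n = f (mkseq u n).
Proof.
pose h n := iter n (fun s => rcons s (f s)) [::].
exists (fun n => f (h n)) => n; congr f.
by elim: n => // n IHn; rewrite mkseqS -IHn.
Qed.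

Lemma subseq_mkseq (T : eqType) (d : nat -> T) (m : nat -> nat) :
  (forall i, m i < m i.+1) ->
  forall i N, (forall j, j < i -> m j < N) ->
  subseq (mkseq (d \o m) i) (mkseq d N).
Proof.
move=> m_incr; elim=> [|i IHi] N mN; first by rewrite sub0seq.
rewrite mkseqS; have miN : m i < N by exact: mN.
apply: (@subseq_trans _ (mkseq d (m i).+1)).
  rewrite mkseqS -!cats1; apply: cat_subseq => //; apply: IHi => j ji.
  exact: (homo_ltn ltn_trans m_incr).
by rewrite /mkseq -(subnKC miN) iotaD map_cat; exact: prefix_subseq.
Qed.

(** * Strategies good against all subsequences *)

(** The intersection of the answers of [sigma] to [acc] followed by any
    subsequence of [s]; there are finitely many, so it is again a legal answer
    for Player alpha. *)
Fixpoint response {X : topologicalType} (sigma : seq X -> set X)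
    (acc s : seq X) : set X :=
  if s is d :: s' then
    response sigma acc s' `&` response sigma (rcons acc d) s'
  else sigma acc.

Lemma response_subseq {X : topologicalType} (sigma : seq X -> set X)
    (acc s t : seq X) :
  subseq t s -> response sigma acc s `<=` sigma (acc ++ t).
Proof.
elim: s acc t => [|d s IHs] acc t /=.
  by case: t => // _; rewrite cats0.
case: t => [_|y t]; first by move=> z [/(IHs acc [::] (sub0seq _))].
case: eqP => [-> ts|_ ts] z [z1 z2]; last exact: IHs z1.
by have := IHs (rcons acc d) t ts z z2; rewrite cat_rcons.
Qed.

Lemma response_open_nbhs {X : topologicalType} (x : X)
    (sigma : seq X -> set X) :
  alpha_strategy x sigma ->
  forall acc s, open_nbhs x (response sigma acc s).
Proof.
move=> hs acc s; elim: s acc => [|d s IHs] acc //=.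
exact: open_nbhsI.
Qed.

(** Here [d] is the list of all points ever chosen, at [x] or elsewhere, and
    [m] selects some of them.  Each selected point after the first has to obey
    the answer to a history that already contains the previously selected
    point; the history may also contain many points far from [x]. *)
Definition subsequence_strategy {X : topologicalType} (x : X)
    (tau : seq X -> set X) :=
  alpha_strategy x tau /\
  forall (d : nat -> X) (m : nat -> nat),
    (forall i, exists2 N, m i < N <= m i.+1 & tau (mkseq d N) (d (m i.+1))) ->
    forall U, nbhs x U -> exists i, U (d (m i)).

(** Playing [response] makes any selected subsequence a legal play against the
    original winning strategy. *)
Lemma W_point_subsequence {X : topologicalType} (x : X) :
  W_point x -> exists tau, subsequence_strategy x tau.
Proof.
move=> [sigma [hsigma win]]; exists (response sigma [:: x]); split.
  by move=> s; exact: response_open_nbhs.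
move=> d m hm U xU.
have m_incr i : m i < m i.+1.
  by have [N /andP[mN Nm] _] := hm i; exact: leq_trans mN Nm.
(* The play starts at x, which takes the place of d (m 0); thus the first
   selected point is left unconstrained. *)
pose xs i := if i is i'.+1 then d (m i'.+1) else x.
have xsE i : mkseq xs i.+1 = x :: mkseq (d \o (m \o succn)) i.
  by rewrite /mkseq /= (iotaDl 1 0) -map_comp.
have play : is_play x xs (fun i => sigma (mkseq xs i.+1)).
  split=> // i; rewrite xsE -cat1s.
  have [N /andP[mN Nm]] := hm i; apply: response_subseq.
  apply: subseq_mkseq => [j|j ji]; first exact: m_incr.
  apply: leq_ltn_trans mN.
  exact: (homo_leq leqnn leq_trans (fun j => ltnW (m_incr j))).
(* Clustering gives infinitely many visits to U, hence one at an index other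
   than 0, where the play visits a selected point and not x itself. *)
have inf := win _ _ play (fun=> erefl) U xU.
apply: contrapT => noU; apply: inf.
apply: (@sub_finite_set _ _ `I_1); last exact: finite_II.
move=> [|i] //= Ui; case: noU; exists i.+1; exact: Ui.
Qed.

(** * An omega-branching tree on the natural numbers *)

(** Any function with [parent_le] and [parent_infinite] would serve: nodes are
    created in the order of their numbers, and each one receives infinitely
    many children. *)
Definition parent n := logn 2 n.

Lemma parent_le n : parent n.+1 <= n.
Proof. by rewrite -ltnS; exact: ltn_logl. Qed.

Lemma parent_infinite j N : exists2 n, N <= n & parent n.+1 = j.
Proof.
have k0 : 0 < 2 ^ j * 3 ^ N by rewrite muln_gt0 !expn_gt0.
exists (2 ^ j * 3 ^ N).-1; rewrite ?prednK //.
  rewrite -ltnS prednK //; apply: (leq_trans (ltn_expl N (isT : 1 < 3))).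
  by rewrite leq_pmull // expn_gt0.
by rewrite /parent lognM ?expn_gt0 // !lognX !logn_prime //= muln1 muln0 addn0.
Qed.

Inductive descendant (j : nat) : nat -> Prop :=
| descendant_refl : descendant j j
| descendant_child n : descendant j (parent n.+1) -> descendant j n.+1.

Lemma descendant_ge j e : descendant j e -> j <= e.
Proof.
by elim=> // n _ jn; exact: leq_trans jn (leqW (parent_le n)).
Qed.

Lemma descendant0 e : descendant 0 e.
Proof.
elim/ltn_ind: e => -[|n] IHn; first exact: descendant_refl.
by apply: descendant_child; apply: IHn; rewrite ltnS parent_le.
Qed.

Lemma descendant_split j e : descendant j e ->
  e = j \/ exists2 n, parent n.+1 = j & descendant n.+1 e.
Proof.
elim=> [|n _ [pj|[k kj dk]]]; first by left.
- by right; exists n => //; exact: descendant_refl.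
- by right; exists k => //; exact: descendant_child.
Qed.

(** * Growing a tree of points *)

(** The rules tie each node to its parent: [tree_sub] nests the neighborhoods,
    [tree_avoid] drives the ranks [r] to infinity along branches, and
    [tree_resp] makes every child a legal move in the game at its parent,
    against all the points chosen before it. *)
Record point_tree {X : topologicalType} (Z : set X) (E : nat -> set X)
    (r : X -> nat) (tau : X -> seq X -> set X)
    (d : nat -> X) (O : nat -> set X) : Prop := PointTree {
  tree_in : forall n, Z (d n);
  tree_mem : forall n, O n (d n);
  tree_sub : forall n, O n.+1 `<=` O (parent n.+1);
  tree_avoid : forall n,
    closure (O n.+1) `<=` ~` E (r (d (parent n.+1)));
  tree_resp : forall n,
    O n.+1 `<=` tau (d (parent n.+1)) (mkseq d n.+1) }.
Arguments tree_in {X Z E r tau d O}.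
Arguments tree_mem {X Z E r tau d O}.
Arguments tree_sub {X Z E r tau d O}.
Arguments tree_avoid {X Z E r tau d O}.
Arguments tree_resp {X Z E r tau d O}.

Lemma regular_shrink (X : topologicalType) (x : X) (U : set X) :
  regular_space X -> nbhs x U ->
  exists O, [/\ open O, O x & closure O `<=` U].
Proof.
move=> hreg /(hreg x)[B xB BU]; exists (interior B); split=> //.
- exact: open_interior.
- exact: subset_trans (closureS (@interior_subset _ B)) BU.
Qed.

(** For closed [C] this says that the trace of [C] on the subspace [Z] is nowhere
    dense in [Z]. *)
Definition rel_nowhere_dense {X : topologicalType} (Z C : set X) :=
  forall G, open G -> G `&` Z !=set0 -> (G `&` Z) `\` C !=set0.

Lemma point_tree_exists {X : topologicalType} (Z : set X) (E : nat -> set X)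
    (r : X -> nat) (tau : X -> seq X -> set X) :
  regular_space X -> (forall x, alpha_strategy x (tau x)) ->
  Z !=set0 -> (forall n, closed (E n)) ->
  (forall n, rel_nowhere_dense Z (E n)) ->
  exists d O, point_tree Z E r tau d O.
Proof.
move=> hreg htau [z0 Zz0] Ecl End.
pose good (a : X * set X) := [/\ Z a.1, open a.2 & a.2 a.1].
(* A node and its neighborhood, together with the points chosen so far, can be
   extended by a child. *)
have ext (ah : (X * set X) * seq X) : exists b : X * set X, good ah.1 ->
    [/\ good b, b.2 `<=` ah.1.2, closure b.2 `<=` ~` E (r ah.1.1) &
        b.2 `<=` tau ah.1.1 ah.2].
  case: ah => [[p P] h] /=; have [/= [Zp oP Pp]|] := pselect (good (p, P));
    last by exists (p, P).
  have [oT Tp] := htau p h.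
  have [q [[[Pq Tq] Zq] Eq]] : (P `&` tau p h `&` Z) `\` E (r p) !=set0.
    by apply: End; [exact: openI|exists p].
  have [] := @regular_shrink X q ((P `&` tau p h) `\` E (r p)) hreg.
    apply: open_nbhs_nbhs; split=> //; apply: openI; first exact: openI.
    by rewrite openC.
  move=> O [oO Oq clO]; exists (q, O) => _; split=> //=.
  - by move=> y /subset_closure/clO[[]].
  - by move=> y /clO[].
  - by move=> y /subset_closure/clO[[]].
have [g hg] := choice ext.
pose f (s : seq (X * set X)) := if s is _ :: _ then
    g (nth (z0, setT) s (parent (size s)), map fst s) else (z0, setT).
have [u hu] := history_recursion _ f.
have uS n : u n.+1 = g (u (parent n.+1), mkseq (fst \o u) n.+1).
  rewrite hu {1}/mkseq [iota _ _]/= /f /= -/(iota 0 n.+1) -map_comp.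
  rewrite size_map size_iota; congr (g (_, _)).
  by rewrite -[_ :: _]/(mkseq u n.+1) nth_mkseq // ltnS parent_le.
have gu n : good (u n).
  elim/ltn_ind: n => -[_|n IHn]; first by rewrite hu; split=> //; exact: openT.
  by rewrite uS; case: (hg (u (parent n.+1), mkseq (fst \o u) n.+1));
    first by apply: IHn; rewrite ltnS parent_le.
have step n := hg (u (parent n.+1), mkseq (fst \o u) n.+1) (gu _).
exists (fst \o u), (snd \o u); split=> n.
- by case: (gu n).
- by case: (gu n).
- by rewrite /= uS; case: (step n).
- by rewrite /= uS; case: (step n).
- by rewrite /= uS; case: (step n).
Qed.

Section PointTree.
Context {X : topologicalType} {Z : set X} {E : nat -> set X} {r : X -> nat}
  {tau : X -> seq X -> set X} {d : nat -> X} {O : nat -> set X}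
  (tree : point_tree Z E r tau d O).

Lemma descendant_sub j e : descendant j e -> O e `<=` O j.
Proof.
by elim=> // n _; exact: subset_trans (tree_sub tree n).
Qed.

Context (htau : forall x, subsequence_strategy x (tau x)).

(** Otherwise there are stray points outside [U] in arbitrarily late branches
    below [j].  Choosing each stray point in a branch opened after the previous
    one was created yields a play at [d j] that never enters [U]. *)
Lemma branches_converge j U : nbhs (d j) U -> exists K, forall n e,
    K <= n -> parent n.+1 = j -> descendant n.+1 e -> U (d e).
Proof.
move=> jU; apply: contrapT => noK.
have stray K : exists e, (exists n,
    [/\ K <= n, parent n.+1 = j & descendant n.+1 e]) /\ ~ U (d e).
  apply: contrapT => noe; apply: noK; exists K => n e Kn nj ne.
  by apply: contrapT => nU; apply: noe; exists e; split=> //; exists n.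
have [F hF] := choice stray.
pose m i := iter i (fun k => F k.+1) (F 0).
have [_ /(_ d m)] := htau (d j); move=> /(_ _ U jU)[i|i].
  (* N is the root of the branch of the next stray point: the answer that this
     root obeyed, and with it its whole branch, already took d (m i) into
     account. *)
  have [[n [mn nj ne]] _] := hF (m i).+1.
  exists n.+1; first by rewrite leqW //= (descendant_ge _ _ ne).
  have := tree_resp tree n; rewrite nj; apply.
  apply: (descendant_sub _ _ ne); exact: (tree_mem tree).
by case: i => [|i]; [case: (hF 0)|case: (hF (m i).+1)].
Qed.

Definition subtree j := d @` [set e | descendant j e].

(** A closed neighborhood of [d j] missing [z] absorbs all but finitely many of
    the branches below [j], and closure commutes with finite unions. *)
Lemma closure_subtree :
  regular_space X -> accessible_space X -> forall j z,
  closure (subtree j) z -> z != d j ->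
  exists2 n, parent n.+1 = j & closure (subtree n.+1) z.
Proof.
move=> hreg hT1 j z jz zj.
have [|W [oW Wj Wz]] := @regular_shrink X (d j) (~` [set z]) hreg.
  apply: open_nbhs_nbhs; split; last by move=> /= e; rewrite e eqxx in zj.
  by rewrite openC; exact: accessible_closed_set1.
have [K hK] := branches_converge j W (open_nbhs_nbhs (conj oW Wj)).
pose D := [set n | n < K /\ parent n.+1 = j].
pose C := closure W `|` \bigcup_(n in D) closure (subtree n.+1).
have clC : closed C.
  apply: closedU; first exact: closed_closure.
  apply: closed_bigcup => [|n _]; last exact: closed_closure.
  by apply: (@sub_finite_set _ _ `I_K); [move=> n []|exact: finite_II].
have sub : subtree j `<=` C.
  move=> _ [e je <-]; have [->|[n nj ne]] := descendant_split _ _ je.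
    by left; exact: subset_closure.
  case: (leqP K n) => Kn.
    by left; apply: subset_closure; exact: hK Kn nj ne.
  by right; exists n => //; apply: subset_closure; exists e.
have : C z by rewrite (iffLR (closure_id _) clC); exact: closureS sub _ jz.
by case=> [/Wz/(_ erefl)|[n [_ nj] nz]] //; exists n.
Qed.

(** A limit point outside the tree would follow an infinite branch, along which
    the ranks increase strictly, and thereby escape every [E n]. *)
Lemma tree_closed :
  regular_space X -> accessible_space X -> closed Z ->
  (forall z, Z z -> E (r z) z) -> (forall m n, m <= n -> E m `<=` E n) ->
  closed (range d).
Proof.
move=> hreg hT1 Zcl Er Emono z clz; apply: contrapT => nz.
have zd j : z != d j by apply/eqP => zj; apply: nz; exists j.
have Zz : Z z.
  rewrite (iffLR (closure_id _) Zcl); apply: closureS clz.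
  by move=> _ [n _ <-]; exact: (tree_in tree).
(* The rank of a child exceeds that of its parent, as the child avoids all
   the E m with m up to the rank of the parent. *)
have deep k : exists2 j, k <= r (d j) & closure (subtree j) z.
  elim: k => [|k [j kj jz]].
    exists 0 => //; apply: closureS clz => _ [e _ <-]; exists e => //.
    exact: descendant0.
  have [n nj nz'] := closure_subtree hreg hT1 j z jz (zd j).
  exists n.+1 => //; apply: (leq_ltn_trans kj); rewrite ltnNge.
  apply/negP => /Emono sub.
  apply: (tree_avoid tree n (d n.+1)).
    by apply: subset_closure; exact: (tree_mem tree).
  by rewrite nj; apply: sub; apply: Er; exact: (tree_in tree).
have [j kj jz] := deep (r z).
have [n nj nz'] := closure_subtree hreg hT1 j z jz (zd j).
apply: (tree_avoid tree n z).
  apply: closureS nz' => _ [e ne <-]; apply: (descendant_sub _ _ ne).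
  exact: (tree_mem tree).
by rewrite nj; apply: Emono kj _ _; exact: Er.
Qed.

Lemma tree_crowded :
  (forall z, Z z -> E (r z) z) -> range d `<=` limit_point (range d).
Proof.
move=> Er _ [j _ <-] U jU.
have [K hK] := branches_converge j U jU.
have [n Kn nj] := parent_infinite j K.
exists (d n.+1); split; [|by exists n.+1|].
  apply/eqP => e; apply: (tree_avoid tree n (d n.+1)).
    by apply: subset_closure; exact: (tree_mem tree).
  by rewrite nj -e; apply: Er; exact: (tree_in tree).
exact: hK Kn nj (descendant_refl _).
Qed.

End PointTree.

(** * Countable perfect sets in meager closed sets *)

Lemma rel_nowhere_dense_bigcup {X : topologicalType} (Z : set X)
    (C : nat -> set X) :
  (forall n, closed (C n)) -> (forall n, rel_nowhere_dense Z (C n)) ->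
  forall n, rel_nowhere_dense Z (\bigcup_(i in `I_n) C i).
Proof.
move=> Ccl Cnd; elim=> [|n IHn] G oG GZ.
  by have [z ?] := GZ; exists z; split=> // -[].
have [z [[Gz Cz] Zz]] : (G `\` C n) `&` Z !=set0.
  by have [z [[]]] := Cnd n G oG GZ; exists z.
have [|y [[[Gy Cy] Zy] ny]] := IHn (G `\` C n) _
  (ex_intro _ z (conj (conj Gz Cz) Zz)).
  by apply: openI => //; rewrite openC.
exists y; split=> // -[i /= + Ci]; rewrite ltnS leq_eqVlt => /orP[/eqP ein|il].
  by apply: Cy; rewrite -ein.
by apply: ny; exists i.
Qed.

(** The increasing finite unions of the [C n] are needed for the ranks: missing
    one of them means missing all the previous ones. *)
Lemma countable_perfect_exists {X : topologicalType} (Z : set X)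
    (C : nat -> set X) :
  regular_space X -> accessible_space X -> W_space X ->
  closed Z -> Z !=set0 ->
  (forall n, closed (C n)) -> (forall n, rel_nowhere_dense Z (C n)) ->
  Z `<=` \bigcup_n C n ->
  exists2 P : set X, nonvoid_perfect P & countable P.
Proof.
move=> hreg hT1 hW Zcl Z0 Ccl Cnd Zcov.
pose E n := \bigcup_(i in `I_n) C i.
have Ecl n : closed (E n) by apply: closed_bigcup => //; exact: finite_II.
have Emono m n : m <= n -> E m `<=` E n.
  by move=> mn z [i im Ci]; exists i => //; exact: leq_trans im mn.
have [tau htau] := choice (fun x => W_point_subsequence x (hW x)).
have rank z : exists n, Z z -> E n z.
  have [/Zcov[n _ Cn]|] := pselect (Z z); last by exists 0.
  by exists n.+1 => _; exists n => /=.
have [r Er] := choice rank.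
have [d [O tree]] := point_tree_exists Z E r tau hreg
  (fun x => proj1 (htau x)) Z0 Ecl (rel_nowhere_dense_bigcup Z C Ccl Cnd).
exists (range d); last exact: card_image_le.
split; first by exists (d 0); exists 0.
have cl := tree_closed tree htau hreg hT1 Zcl Er Emono.
split=> //; apply/seteqP; split; last exact: tree_crowded tree htau Er.
by move=> z /subset_limit_point; rewrite -(iffLR (closure_id _) cl).
Qed.

(** * Transfer between a closed set and the ambient space *)

Lemma nbhs_set_type {X : topologicalType} (F : set X) (y : set_type F)
    (B : set (set_type F)) :
  nbhs y B ->
  exists G, [/\ open G, G (set_val y) & set_val @^-1` G `<=` B].
Proof.
by rewrite nbhsE => -[_ [[G oG <-] Gy] GB]; exists G.
Qed.

Lemma nowhere_dense_image {X : topologicalType} (F : set X)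
    (N : set (set_type F)) :
  nowhere_dense N -> rel_nowhere_dense F (closure (set_val @` N)).
Proof.
move=> Nnd G oG [x [Gx Fx]]; apply: contrapT => none.
suff : interior (closure N) (exist _ x (mem_set Fx)) by rewrite Nnd.
rewrite /interior /= nbhsE; exists (set_val @^-1` G).
  by split; [exists G|].
move=> y Gy B /nbhs_set_type[H [oH Hy HB]].
have cly : closure (set_val @` N) (set_val y).
  apply: contrapT => ny; apply: none; exists (set_val y); split=> //.
  by split=> //; exact: set_valP.
have [_ [[n Nn <-] Hn]] := cly H (open_nbhs_nbhs (conj oH Hy)).
by exists n; split=> //; exact: HB.
Qed.

(** Every open set that meets the closure of [V `&` F] already meets
    [V `&` F], and there it can be shrunk inside [V]. *)
Lemma regular_closed_piece {X : topologicalType} (F V C : set X) :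
  open V -> rel_nowhere_dense F C ->
  rel_nowhere_dense (closure (V `&` F)) C.
Proof.
move=> oV Cnd G oG [z [Gz clz]].
have [y [[Vy Fy] Gy]] := clz G (open_nbhs_nbhs (conj oG Gz)).
have [||w [[[Gw Vw] Fw] Cw]] := Cnd (G `&` V).
- exact: openI.
- by exists y.
- by exists w; do ! split=> //; exact: subset_closure.
Qed.

(** The fibers of an injection of [P] into the natural numbers have at most one
    point, hence so do their closures; an open set inside such a closure would
    isolate a point of [P]. *)
Lemma perfect_countable_meager {X : topologicalType} (P : set X) :
  accessible_space X -> nonvoid_perfect P -> countable P ->
  meager (@setT (set_type P)).
Proof.
move=> hT1 [_ [_ Plim]] /countable_injP[f finj].
exists (fun n => [set y | f (set_val y) = n]); last first.
  by move=> y _; exists (f (set_val y)).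
move=> n; apply/seteqP; split=> // y.
(* As a fiber of f, the set below contains at most w, and T1 keeps its
   closure from containing more. *)
have uniq_cl (a w : set_type P) : closure [set y | f (set_val y) = n] a ->
    f (set_val w) = n -> set_val a = set_val w.
  move=> cla fw; apply: contrapT => /eqP/hT1[A [oA /set_mem Aa /set_mem Aw]].
  have [|b [/= fb Ab]] := cla (set_val @^-1` A).
    by apply: open_nbhs_nbhs; split=> //; exists A.
  apply: Aw; suff -> : set_val w = set_val b by [].
  by apply: finj; rewrite ?inE ?fw ?fb //; exact: set_valP.
rewrite /interior /= => /nbhs_set_type[G [oG Gy Gcl]].
have [w [fw _]] := Gcl y Gy setT filterT.
have : limit_point P (set_val y) by rewrite Plim; exact: set_valP.
move=> /(_ G (open_nbhs_nbhs (conj oG Gy)))[x [/eqP xy Px Gx]].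
apply: xy; rewrite (uniq_cl y w) //; last exact: Gcl.
have clx : closure [set y | f (set_val y) = n] (exist _ x (mem_set Px)).
  exact: Gcl.
by rewrite -(uniq_cl _ w clx fw).
Qed.

Theorem theorem5p2p9 (X : topologicalType) (hreg : regular_space X)
    (hT1 : accessible_space X) (hW : W_space X) :
  hereditarily_baire X <->
  (forall P : set X, nonvoid_perfect P -> ~ countable P).
Proof.
split=> [hB P hP cP | hP F Fcl F0 U oU [y Uy] [N Nnd UN]].
  have [P0 [Pcl _]] := hP; have [x Px] := P0.
  apply: (hB P Pcl P0 setT openT); first by exists (exist _ x (mem_set Px)).
  exact: perfect_countable_meager.
case: oU UN Uy => G oG <- UN Gy.
have [V [oV Vy VG]] := regular_shrink X (set_val y) G hreg
  (open_nbhs_nbhs (conj oG Gy)).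
(* Regularity keeps the closure of V inside G, where the meager cover is
   available. *)
have cover : closure (V `&` F) `<=` \bigcup_n closure (set_val @` N n).
  move=> z clz.
  have Fz : F z.
    rewrite (iffLR (closure_id _) Fcl).
    by apply: closureS clz; exact: subIsetr.
  have Gz : G z by apply: VG; apply: closureS clz; exact: subIsetl.
  have [n _ Nz] := UN (exist _ z (mem_set Fz)) Gz.
  by exists n => //; apply: subset_closure; exists (exist _ z (mem_set Fz)).
have [|n|n|P hPP cP] := countable_perfect_exists (closure (V `&` F))
  (fun n => closure (set_val @` N n)) hreg hT1 hW
  (@closed_closure _ _) _ _ _ cover.
- exists (set_val y); apply: subset_closure; split=> //; exact: set_valP.
- exact: closed_closure.
- exact/regular_closed_piece/nowhere_dense_image.
- exact: hP P hPP cP.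
Qed.
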